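(* Let $l\ge1$ and let $C_1,\dots,C_l\subseteq\mathbb{Z}_2^n$ be a family of downsets which satisfies the antichain condition. If $$\mathrm{E}[C]=\binom{n}{0}+\binom{n}{1}+\dots+\binom{n}{k-1}+p\binom{n}{k}$$ for some integer $k\ge0$ and real number $0\le p<1$, then $$\mathrm{E}[\delta C]\ \ge\ \binom{n}{1}+\binom{n}{2}+\dots+\binom{n}{k}+p\binom{n}{k+1}.$$
   Context: Identify each $x\in\mathbb{Z}_2^n$ with its support $\{j : x_j=1\}\subseteq[n]=\{1,\dots,n\}$, so that subsets of $\mathbb{Z}_2^n$ are families of subsets of $[n]$. A downset is a family closed under taking subsets (the empty family is allowed). The upper shadow of a family $\mathcal{F}$ is $\delta\mathcal{F}=\{J\cup\{i\} : J\in\mathcal{F},\ i\in[n]\setminus J\}$. The family $C_1,\dots,C_l$ of downsets satisfies the antichain condition if for all $i,j$ the set $C_i\setminus C_j$ is an antichain with respect to inclusion; equivalently, $C_j\supseteq\partial C_i$, where $\partial\mathcal{F}=\{J\setminus\{a\} : J\in\mathcal{F},\ a\in J\}$. Averages: $\mathrm{E}[C]=\frac1l\sum_{m=1}^l|C_m|$ and $\mathrm{E}[\delta C]=\frac1l\sum_{m=1}^l|\delta(C_m)|$. Convention: $\binom{n}{k}=0$ for $n<k$; for $k=0$ the assumption reads $\mathrm{E}[C]=p$ and the conclusion reads $\mathrm{E}[\delta C]\ge p\binom{n}{1}$. *)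

(* Defs.v *)
From mathcomp Require Import all_boot all_order all_algebra.

Set Implicit Arguments.
Unset Strict Implicit.
Unset Printing Implicit Defensive.

Import GRing.Theory Num.Theory.
Local Open Scope ring_scope.

(* An element of Z_2^n is represented by its support, a set of type
   {set 'I_n}; a subset of Z_2^n is then a family of type {set {set 'I_n}}. *)

Definition downset (n : nat) (F : {set {set 'I_n}}) : Prop :=
  forall A B : {set 'I_n}, A \subset B -> B \in F -> A \in F.

Definition antichain (n : nat) (F : {set {set 'I_n}}) : Prop :=
  forall A B : {set 'I_n}, A \in F -> B \in F -> A \subset B -> A = B.

Definition upper_shadow (n : nat) (F : {set {set 'I_n}}) : {set {set 'I_n}} :=
  [set J :|: [set i] | J in F, i in ~: J].

Definition antichain_condition (n l : nat)
    (C : 'I_l -> {set {set 'I_n}}) : Prop :=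
  forall i j : 'I_l, antichain (C i :\: C j).

Definition average_card (R : realFieldType) (n l : nat)
    (C : 'I_l -> {set {set 'I_n}}) : R :=
  (\sum_(m < l) #|C m|%:R) / l%:R.

(* Main.v *)
Require Import Defs.
From mathcomp Require Import all_boot all_order all_algebra.
From mathcomp Require Import zify ring lra.

Set Implicit Arguments.
Unset Strict Implicit.
Unset Printing Implicit Defensive.

Import Order.TTheory GRing.Theory Num.Theory.
Local Open Scope ring_scope.

(** The target function is the piecewise linear G_n determined by
    G_n (bin_sum n k p) = bin_sum n k.+1 p for 0 <= p <= 1, where bin_sum n k p
    is the size of k full layers of the n-cube plus a fraction p of the next:
    G_n sends the size of a Hamming ball to the size of the ball of radius one
    larger. Since a shadow omits the empty set, the theorem says that
    1 + E[delta C] >= G_n (E[C]).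

    Only concavity of G_n matters besides Pascal's rule. The breakpoint slopes
    C(n, k+1) / C(n, k) decrease in k, so G_n is concave
    ([bin_sum_supergradient], [bin_sum_concave]). Pascal's rule makes
    s = bin_sum n.+1 k.+1 p split as s = t + G_n t with t = bin_sum n k p, and
    then G_(n+1) s = G_n t + G_n (G_n t).

    The proof is by induction on a ground set S, removing a point a. Each C_m
    splits into its deletion D_m (members avoiding a) and its link L_m (members
    containing a, with a removed); both families inherit the hypotheses. Members
    of the shadow of C_m that avoid a include the shadow of D_m, and those that
    contain a include, after removing a, both D_m and the shadow of L_m
    ([card_shadow_split]). With x0 = E[D] and x1 = E[L], if every C_m contains
    the empty set, this gives
      1 + E[delta C] >= G_n x0 + max (x0, G_n x1),
    and it remains to see that the right-hand side is at least
    G_(n+1) (x0 + x1). Write x0 + x1 = t + G_n t. If x0 >= G_n t, then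
    G_n x0 + x0 already suffices because G_n is nondecreasing. Otherwise
    t <= x1 <= x0 <= G_n t, and concavity says that
    G_n x0 + G_n x1 is at least its value G_n (G_n t) + G_n t at the more spread
    pair with the same sum ([expansion_bound_step]).

    The antichain condition enters through [antichain_dichotomy]: either every
    C_m contains the empty set, or every C_m is contained in {set0}; in the
    second case shadows are explicit. Some such hypothesis is needed, since
    concavity of G_n goes the wrong way for averages of unrelated downsets: for
    {set0} and the full cube the inequality fails in general. *)

(** * The concave profile of Hamming balls *)

Definition bin_sum (R : realFieldType) (n k : nat) (p : R) : R :=
  \sum_(0 <= i < k) 'C(n, i)%:R + p * 'C(n, k)%:R.

Lemma bin_sumS (R : realFieldType) (n k : nat) (p : R) :
  bin_sum n k.+1 p = bin_sum n k 1 + p * 'C(n, k.+1)%:R.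
Proof. by rewrite /bin_sum big_nat_recr //= mul1r. Qed.

Lemma bin_sum0 (R : realFieldType) (n : nat) (p : R) : bin_sum n 0 p = p.
Proof. by rewrite /bin_sum big_nil bin0 add0r mulr1. Qed.

Lemma bin_sum1 (R : realFieldType) (n : nat) (p : R) :
  bin_sum n 1 p = 1 + n%:R * p.
Proof. by rewrite bin_sumS bin_sum0 bin1 mulrC. Qed.

Lemma bin_sum_affine (R : realFieldType) (n k : nat) (p : R) :
  bin_sum n k p = bin_sum n k 0 + p * 'C(n, k)%:R.
Proof. by rewrite /bin_sum mul0r addr0. Qed.

Lemma bin_sumS0 (R : realFieldType) (n k : nat) :
  bin_sum n k.+1 0 = bin_sum n k 0 + 'C(n, k)%:R :> R.
Proof. by rewrite bin_sumS mul0r addr0 bin_sum_affine mul1r. Qed.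

Lemma bin_sum_pascal (R : realFieldType) (n k : nat) (p : R) :
  bin_sum n.+1 k.+1 p = bin_sum n k.+1 p + bin_sum n k p.
Proof.
rewrite bin_sum_affine [bin_sum n k.+1 p]bin_sum_affine [bin_sum n k p]bin_sum_affine.
suff ->: bin_sum n.+1 k.+1 0 = bin_sum n k.+1 0 + bin_sum n k 0 :> R.
  by rewrite binS natrD; ring.
elim: k => [|k IHk]; first by rewrite !bin_sumS0 !bin_sum0 !bin0 addr0.
have E1 := bin_sumS0 R n k; have E2 := bin_sumS0 R n k.+1.
by rewrite bin_sumS0 IHk binS natrD; lra.
Qed.

Lemma bin_sum_full (R : realFieldType) (n : nat) :
  bin_sum n n.+1 0 = (2 ^ n)%:R :> R.
Proof.
rewrite /bin_sum mul0r addr0 big_mkord -natr_sum; apply: (congr1 (fun m => m%:R)).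
rewrite (expnDn 1 1); apply: eq_bigr => i _.
by rewrite !exp1n !muln1.
Qed.

(** Every admissible average lies on the profile, so values of G_n can be
    compared in the coordinates (k, p). *)
Lemma bin_sum_onto (R : realFieldType) (n : nat) (x : R) :
  0 <= x <= (2 ^ n)%:R ->
  exists k (p : R), [/\ (k <= n)%N, 0 <= p <= 1 & x = bin_sum n k p].
Proof.
rewrite -bin_sum_full => /andP[x0].
suff H m : (m <= n.+1)%N -> (0 < m)%N -> x <= bin_sum n m 0 ->
  exists k (p : R), [/\ (k < m)%N, 0 <= p <= 1 & x = bin_sum n k p].
  by move=> /(H _ (leqnn _) (ltn0Sn _)) [k [p [? ? ?]]]; exists k, p.
elim: m => [//|m IHm] lemn _ xle.
have [xlt|xge] := leP x (bin_sum n m 0).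
  case: m IHm lemn xle xlt => [|m] IHm lemn xle xlt.
    exists 0%N, 0; split=> //; first by rewrite lexx ler01.
    by move: xlt; rewrite bin_sum0 => xlt; apply/le_anti; rewrite xlt x0.
  by have [k [p [? ? ?]]] := IHm (ltnW lemn) isT xlt; exists k, p; split=> //; lia.
have bpos : 0 < 'C(n, m)%:R :> R by rewrite ltr0n bin_gt0; lia.
exists m, ((x - bin_sum n m 0) / 'C(n, m)%:R); split=> //.
  apply/andP; split; first by rewrite divr_ge0 ?subr_ge0 ?ltW.
  by rewrite ler_pdivrMr // mul1r lerBlDl -bin_sumS0.
by rewrite bin_sum_affine divfK ?gt_eqF // addrC subrK.
Qed.

Lemma bin_log_concave (n k j : nat) : (k <= j)%N ->
  ('C(n, k) * 'C(n, j.+1) <= 'C(n, k.+1) * 'C(n, j))%N.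
Proof.
move=> lekj; rewrite -(leq_pmul2l (ltn0Sn k)) -(leq_pmul2l (ltn0Sn j)).
have E1 := mul_bin_left n k; have E2 := mul_bin_left n j.
have -> : (j.+1 * (k.+1 * ('C(n, k) * 'C(n, j.+1)))
           = k.+1 * (n - j) * ('C(n, k) * 'C(n, j)))%N.
  by rewrite -[(_ * (n - j) * _)%N]mulnA [((n - j) * _)%N]mulnCA -E2; ring.
have -> : (j.+1 * (k.+1 * ('C(n, k.+1) * 'C(n, j)))
           = j.+1 * (n - k) * ('C(n, k) * 'C(n, j)))%N.
  by rewrite [(k.+1 * _)%N]mulnA E1; ring.
by rewrite leq_mul2r leq_mul ?orbT //; lia.
Qed.

(** The slope of G_n on the segment of sizes between the balls of radius k - 1
    and k. *)
Definition slope (R : realFieldType) (n k : nat) : R :=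
  'C(n, k.+1)%:R / 'C(n, k)%:R.

Lemma slope_ge0 (R : realFieldType) (n k : nat) : 0 <= slope R n k.
Proof. by rewrite divr_ge0. Qed.

(** The line carrying the k-th segment of G_n lies above the whole graph: along
    the breakpoints, the gap between G_n and the line of slope [slope R n k]
    through the origin increases up to index k and decreases afterwards, by
    log-concavity of the binomial coefficients. *)
Lemma bin_sum_supergradient (R : realFieldType) (n k j : nat) (p q : R) :
  (k <= n)%N -> 0 <= q <= 1 ->
  bin_sum n j.+1 q
    <= bin_sum n k.+1 p + slope R n k * (bin_sum n j q - bin_sum n k p).
Proof.
move=> lekn /andP[q0 q1].
have bpos : 0 < 'C(n, k)%:R :> R by rewrite ltr0n bin_gt0.
pose gap i := bin_sum n i.+1 0 - slope R n k * bin_sum n i 0.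
have gapS i : gap i.+1 = gap i + ('C(n, i.+1)%:R - slope R n k * 'C(n, i)%:R).
  by rewrite /gap [bin_sum n i.+2 0]bin_sumS0 [in slope R n k * _]bin_sumS0; ring.
have gap_max i : gap i <= gap k.
  have [leik|ltki] := leqP i k.
    rewrite -(subKn leik); elim: (k - i)%N => [|d IHd]; first by rewrite subn0.
    have [ltdk|ledk] := ltnP d k; last first.
      by move: IHd; have -> : (k - d.+1 = k - d)%N by lia.
    apply: le_trans IHd; rewrite (_ : k - d = (k - d.+1).+1)%N; last by lia.
    rewrite gapS lerDl subr_ge0 mulrAC ler_pdivrMr // -!natrM ler_nat.
    by rewrite [leqLHS]mulnC bin_log_concave ?leq_subr.
  elim: i ltki => // i IHi; rewrite ltnS => leki.
  apply: (@le_trans _ _ (gap i)); last first.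
    by move: leki; rewrite leq_eqVlt => /predU1P[->|/IHi].
  rewrite gapS gerDl subr_le0 mulrAC ler_pdivlMr // -!natrM ler_nat.
  by rewrite mulnC bin_log_concave.
have eqk : slope R n k * 'C(n, k)%:R = 'C(n, k.+1)%:R by rewrite divfK ?gt_eqF.
(* Inside a segment the gap interpolates its values at the two ends. *)
have le0 : (1 - q) * gap j <= (1 - q) * gap k by rewrite ler_wpM2l ?subr_ge0.
have le1 : q * gap j.+1 <= q * gap k by rewrite ler_wpM2l.
rewrite bin_sum_affine [bin_sum n k.+1 p]bin_sum_affine [bin_sum n j q]bin_sum_affine
        [bin_sum n k p]bin_sum_affine -eqk.
move: le0 le1; rewrite gapS /gap; nra.
Qed.

(** This is y >= G_n x, phrased through the points of the profile below x so that
    G_n need not be inverted or evaluated. *)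
Definition expansion_bound (R : realFieldType) (n : nat) (x y : R) : Prop :=
  forall k p, 0 <= p <= 1 -> bin_sum n k p <= x -> bin_sum n k.+1 p <= y.

Lemma expansion_bound_bin_sum (R : realFieldType) (n k : nat) (p : R) :
  (k <= n)%N -> expansion_bound n (bin_sum n k p) (bin_sum n k.+1 p).
Proof.
move=> lekn j q q01 le_qp.
apply: le_trans (bin_sum_supergradient j p lekn q01) _.
by rewrite gerDl mulr_ge0_le0 ?slope_ge0 ?subr_le0.
Qed.

(** Concavity in the form used below, with the pair (x0, x1) less spread than
    (z0, z1): the increase of G_n from x0 to z0 is paid for by its decrease from
    x1 to z1, as the slope at x1 is at least the slope at x0. Comparing the sums
    by an inequality only uses that slopes are nonnegative. *)
Lemma bin_sum_concave (R : realFieldType) (n k0 k1 j0 j1 : nat)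
    (p0 p1 q0 q1 : R) :
  (k0 <= n)%N -> (k1 <= n)%N ->
  0 <= p0 <= 1 -> 0 <= p1 <= 1 -> 0 <= q0 <= 1 -> 0 <= q1 <= 1 ->
  bin_sum n k1 p1 <= bin_sum n k0 p0 -> bin_sum n k0 p0 <= bin_sum n j0 q0 ->
  bin_sum n j0 q0 + bin_sum n j1 q1 <= bin_sum n k0 p0 + bin_sum n k1 p1 ->
  bin_sum n j0.+1 q0 + bin_sum n j1.+1 q1
    <= bin_sum n k0.+1 p0 + bin_sum n k1.+1 p1.
Proof.
move=> lek0 lek1 p01 p11 q01 q11 le10 le0j lesum.
have s0 := slope_ge0 R n k0; have s1 := slope_ge0 R n k1.
have A0 := bin_sum_supergradient j0 p0 lek0 q01.
have A1 := bin_sum_supergradient j1 p1 lek1 q11.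
have B0 := bin_sum_supergradient k1 p0 lek0 p11.
have B1 := bin_sum_supergradient k0 p1 lek1 p01.
have A2 := bin_sum_supergradient j0 p1 lek1 q01.
move: s0 s1 A0 A1 B0 B1 A2 le10 le0j lesum.
move: (slope R n k0) (slope R n k1) => m0 m1.
move: (bin_sum n k0 p0) (bin_sum n k1 p1) (bin_sum n j0 q0) (bin_sum n j1 q1).
move=> x0 x1 z0 z1 m0_ge0 m1_ge0 A0 A1 B0 B1 A2 le10 le0j lesum.
have [x01|x01] := eqVneq x0 x1.
  have H : m1 * (z0 + z1 - x0 - x1) <= 0 by rewrite mulr_ge0_le0 //; lra.
  by rewrite x01 in B0 B1 H *; lra.
have m01 : m0 <= m1.
  have : 0 <= (m1 - m0) * (x0 - x1) by lra.
  by rewrite pmulr_lge0 ?subr_ge0 // subr_gt0 lt_def x01.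
have H1 : m0 * (z0 - x0) <= m1 * (z0 - x0) by rewrite ler_wpM2r ?subr_ge0.
have H2 : m1 * (z0 + z1 - x0 - x1) <= 0 by rewrite mulr_ge0_le0 //; lra.
lra.
Qed.

(** The numerical core of the induction on the ground set: G_n x0 + z dominates
    G_(n+1) (x0 + x1) as soon as z dominates both x0 and G_n x1. The hypothesis
    1 <= x0 covers the part of the profile below the first layer, where the
    splitting x0 + x1 = t + G_n t has no solution. *)
Lemma expansion_bound_step (R : realFieldType) (n : nat) (x0 x1 y0 y1 z : R) :
  1 <= x0 <= (2 ^ n)%:R -> 0 <= x1 <= x0 ->
  expansion_bound n x0 y0 -> expansion_bound n x1 y1 -> x0 <= z -> y1 <= z ->
  expansion_bound n.+1 (x0 + x1) (y0 + z).
Proof.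
move=> /andP[x0_ge1 x0_le] /andP[x1_ge0 le10] bnd0 bnd1 x0z y1z [|k] p p01.
  have /= := bnd0 0%N 1 _ _; rewrite bin_sum0 !bin_sum1 ler01 lexx.
  move=> /(_ isT x0_ge1) y0_ge _; have /andP[p0 p1] := p01.
  have : n.+1%:R * p <= n.+1%:R by rewrite ler_piMr.
  by rewrite -natr1; lra.
rewrite !bin_sum_pascal => le_sum.
(* The extremal splitting has parts bin_sum n k.+1 p and bin_sum n k p. *)
have [le0|lt0] := leP (bin_sum n k.+1 p) x0.
  by rewrite lerD ?bnd0 // (le_trans le0).
have [|k0 [p0 [lek0 p01' eq0]]] := @bin_sum_onto R n x0.
  by rewrite x0_le (le_trans ler01).
have [|k1 [p1 [lek1 p11 eq1]]] := @bin_sum_onto R n x1.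
  by rewrite x1_ge0 (le_trans le10).
apply: (le_trans (y := bin_sum n k0.+1 p0 + bin_sum n k1.+1 p1)); last first.
  by rewrite lerD ?bnd0 -?eq0 // (le_trans _ y1z) // bnd1 -?eq1.
by apply: bin_sum_concave; rewrite -?eq0 -?eq1 // ltW.
Qed.

(** * Averages *)

Definition mean (R : realFieldType) (l : nat) (f : 'I_l -> nat) : R :=
  (\sum_(m < l) (f m)%:R) / l%:R.

Lemma mean_le (R : realFieldType) (l : nat) (f g : 'I_l -> nat) :
  (forall m, (f m <= g m)%N) -> mean R f <= mean R g.
Proof.
move=> fg; apply: ler_wpM2r; first by rewrite invr_ge0.
by apply: ler_sum => m _; rewrite ler_nat.
Qed.

Lemma meanD (R : realFieldType) (l : nat) (f g : 'I_l -> nat) :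
  mean R (fun m => (f m + g m)%N) = mean R f + mean R g.
Proof.
rewrite /mean -mulrDl -big_split /=; congr (_ / _).
by apply: eq_bigr => m _; rewrite natrD.
Qed.

Lemma meanM (R : realFieldType) (l c : nat) (f : 'I_l -> nat) :
  mean R (fun m => (c * f m)%N) = c%:R * mean R f.
Proof.
rewrite /mean mulrA mulr_sumr; congr (_ / _).
by apply: eq_bigr => m _; rewrite natrM.
Qed.

Lemma mean_const (R : realFieldType) (l c : nat) :
  (1 <= l)%N -> mean R (fun _ : 'I_l => c) = c%:R.
Proof.
move=> l_ge1; rewrite /mean sumr_const card_ord -[_ *+ l]mulr_natr mulfK //.
by rewrite pnatr_eq0 -lt0n.
Qed.

Lemma mean_ge0 (R : realFieldType) (l : nat) (f : 'I_l -> nat) : 0 <= mean R f.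
Proof. by rewrite divr_ge0 // sumr_ge0. Qed.

(** * Shadows, deletions and links *)

(** The shadow relative to a ground set S, so that removing a point shrinks S
    while all families stay over the same type. *)
Definition shadow_in (n : nat) (S : {set 'I_n}) (F : {set {set 'I_n}}) :
  {set {set 'I_n}} := [set J :|: [set i] | J in F, i in S :\: J].

Definition deletion (n : nat) (a : 'I_n) (F : {set {set 'I_n}}) :
  {set {set 'I_n}} := [set J in F | a \notin J].

Definition link (n : nat) (a : 'I_n) (F : {set {set 'I_n}}) :
  {set {set 'I_n}} := [set J : {set 'I_n} | (a \notin J) && (a |: J \in F)].

Lemma set0_notin_shadow (n : nat) (S : {set 'I_n}) (F : {set {set 'I_n}}) :
  set0 \notin shadow_in S F.
Proof.
apply/imset2P => -[J i _ _ /setP/(_ i)].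
by rewrite !inE eqxx orbT.
Qed.

Lemma setU1_inj_notin (n : nat) (a : 'I_n) (F : {set {set 'I_n}}) :
  (forall J : {set 'I_n}, J \in F -> a \notin J) ->
  {in F &, injective (fun J : {set 'I_n} => a |: J)}.
Proof.
by move=> aF A B /aF aA /aF aB eqAB; rewrite -(setU1K aA) eqAB setU1K.
Qed.

Lemma downset_deletion (n : nat) (a : 'I_n) (F : {set {set 'I_n}}) :
  downset F -> downset (deletion a F).
Proof.
move=> dF A B sAB; rewrite !inE => /andP[/(dF _ _ sAB) -> aB] /=.
by apply: contra aB; apply: subsetP.
Qed.

Lemma downset_link (n : nat) (a : 'I_n) (F : {set {set 'I_n}}) :
  downset F -> downset (link a F).
Proof.
move=> dF A B sAB; rewrite !inE => /andP[aB FB]; apply/andP; split.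
  by apply: contra aB; apply: subsetP.
by apply: dF FB; apply: setUS.
Qed.

Lemma antichain_deletion (n l : nat) (a : 'I_n) (C : 'I_l -> {set {set 'I_n}}) :
  antichain_condition C -> antichain_condition (fun m => deletion a (C m)).
Proof.
move=> acC i j A B; rewrite !inE => /andP[Aj /andP[Ai aA]] /andP[Bj /andP[Bi aB]].
rewrite aA andbT in Aj; rewrite aB andbT in Bj.
by apply: (acC i j); rewrite inE ?Aj ?Bj.
Qed.

Lemma antichain_link (n l : nat) (a : 'I_n) (C : 'I_l -> {set {set 'I_n}}) :
  antichain_condition C -> antichain_condition (fun m => link a (C m)).
Proof.
move=> acC i j A B; rewrite !inE => /andP[Aj /andP[aA Ai]] /andP[Bj /andP[aB Bi]] sAB.
rewrite aA /= in Aj; rewrite aB /= in Bj.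
rewrite -(setU1K aA) -(setU1K aB); congr (_ :\ _).
by apply: (acC i j); rewrite ?inE ?Aj ?Bj ?setUS.
Qed.

Lemma card_deletion_link (n : nat) (a : 'I_n) (F : {set {set 'I_n}}) :
  (#|F| = #|deletion a F| + #|link a F|)%N.
Proof.
rewrite -(cardsID [set J : {set 'I_n} | a \notin J] F); congr (_ + _)%N.
  by apply: eq_card => J; rewrite !inE.
rewrite -(card_in_imset (f := fun J : {set 'I_n} => a |: J)
                        (D := mem (link a F))); last first.
  by apply: setU1_inj_notin => J; rewrite inE => /andP[].
apply: eq_card => J; rewrite !inE negbK; apply/andP/imsetP.
  by move=> [aJ FJ]; exists (J :\ a); rewrite ?setD1K // !inE eqxx setD1K.
by move=> [K]; rewrite !inE => /andP[_ FK] ->; rewrite setU11.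
Qed.

Lemma link_sub_deletion (n : nat) (a : 'I_n) (F : {set {set 'I_n}}) :
  downset F -> link a F \subset deletion a F.
Proof.
move=> dF; apply/subsetP => J; rewrite !inE => /andP[-> FJ]; rewrite andbT.
by apply: dF FJ; apply: subsetUr.
Qed.

(** Adding a to a member of the deletion, or adding a point other than a to a
    set a |: L with L in the link, produces a member of the shadow containing a;
    adding a point other than a to a member of the deletion produces one that
    avoids a. *)
Lemma card_shadow_split (n : nat) (S : {set 'I_n}) (a : 'I_n)
    (F : {set {set 'I_n}}) : a \in S ->
  (#|shadow_in (S :\ a) (deletion a F)|
   + #|shadow_in (S :\ a) (link a F) :|: deletion a F| <= #|shadow_in S F|)%N.
Proof.
move=> aS.
have notin (G : {set {set 'I_n}}) :
    (forall J : {set 'I_n}, J \in G -> a \notin J) ->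
    forall J : {set 'I_n}, J \in shadow_in (S :\ a) G -> a \notin J.
  move=> aG J /imset2P[K i /aG aK]; rewrite !inE => /and3P[_ ia _] ->.
  by rewrite !inE negb_or aK eq_sym.
have notin_del : forall J : {set 'I_n}, J \in deletion a F -> a \notin J.
  by move=> J; rewrite inE => /andP[].
have notin_link : forall J : {set 'I_n}, J \in link a F -> a \notin J.
  by move=> J; rewrite inE => /andP[].
have inj : {in shadow_in (S :\ a) (link a F) :|: deletion a F &,
             injective (fun J : {set 'I_n} => a |: J)}.
  by apply: setU1_inj_notin => J /setUP[/notin|/notin_del]; first apply.
rewrite -(card_in_imset inj) -cardsUI.
set X := shadow_in _ _; set Y := imset _ _.
have -> : X :&: Y = set0.
  apply/setP => J; rewrite !inE; apply/negP => /andP[/(notin _ notin_del) aJ].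
  by move=> /imsetP[K _ JK]; rewrite JK setU11 in aJ.
rewrite cards0 addn0 subset_leq_card // subUset; apply/andP; split.
  apply/subsetP => J /imset2P[K i]; rewrite !inE => /andP[FK _] /and3P[iK _ iS] ->.
  by apply: imset2_f; rewrite ?inE ?iK.
apply/subsetP => _ /imsetP[K /setUP KU ->]; case: KU => [/imset2P[L i]|].
  rewrite !inE => /andP[aL FL] /and3P[iL ia iS] ->.
  by rewrite setUA; apply: imset2_f; rewrite ?inE // negb_or ia iL.
rewrite inE => /andP[FK aK].
by rewrite setUC; apply: imset2_f; rewrite ?inE ?aK.
Qed.

Lemma card_shadow_trivial (n : nat) (S : {set 'I_n}) (F : {set {set 'I_n}}) :
  F \subset [set set0] -> (#|S| * #|F| <= #|shadow_in S F|)%N.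
Proof.
rewrite subset1 => /orP[]/eqP->; last by rewrite cards0 muln0.
rewrite cards1 muln1 -(card_imset _ (@set1_inj 'I_n)) subset_leq_card //.
apply/subsetP => J /imsetP[i iS ->].
by rewrite -(set0U [set i]); apply: imset2_f; rewrite ?inE.
Qed.

(** A downset without the empty set is empty, and then the condition makes every
    other C i an antichain; a downset that is an antichain has no member besides
    the empty set. *)
Lemma antichain_dichotomy (n l : nat) (C : 'I_l -> {set {set 'I_n}}) :
  (forall m, downset (C m)) -> antichain_condition C ->
  (forall m, set0 \in C m) \/ (forall m, C m \subset [set set0]).
Proof.
move=> dC acC; have [/forallP|] := boolP [forall m, set0 \in C m]; first by left.
rewrite negb_forall => /existsP[j Cj0]; right=> i; apply/subsetP => A Ai.
have Cj B : B \notin C j by apply: contra Cj0; apply: dC; apply: sub0set.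
have Ci0 : set0 \in C i by apply: dC Ai; apply: sub0set.
by rewrite inE eq_sym (acC i j _ A _ _ (sub0set A)) ?inE ?Cj.
Qed.

(** * The averaged isoperimetric inequality *)

(** The summand 1 stands for the empty set, which no shadow contains; with it
    the bound is an exact Pascal recursion in the size of S. *)
Lemma mean_shadow_bound (R : realFieldType) (n l : nat) (S : {set 'I_n})
    (C : 'I_l -> {set {set 'I_n}}) : (1 <= l)%N ->
  (forall m, C m \subset powerset S) ->
  (forall m, downset (C m)) -> antichain_condition C ->
  expansion_bound #|S| (mean R (fun m => #|C m|))
    (1 + mean R (fun m => #|shadow_in S (C m)|)).
Proof.
move=> l_ge1; have [s leS] := ubnP #|S|.
elim: s S C leS => // s IHs S C leS sCS dC acC.
(* Here x <= 1 is the weight of {set0} and the bound reads 1 + #|S| x, the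
   value of the profile on its first segment. *)
have trivial : (forall m, C m \subset [set set0]) ->
    expansion_bound #|S| (mean R (fun m => #|C m|))
      (1 + mean R (fun m => #|shadow_in S (C m)|)).
  move=> C0 k p p01; set x := mean R _ => le_kx.
  have := @expansion_bound_bin_sum R #|S| 0 x (leq0n _) k p p01.
  rewrite bin_sum0 bin_sum1 => /(_ le_kx) /le_trans; apply.
  by rewrite lerD2l -meanM mean_le // => m; apply: card_shadow_trivial.
have [S0|[a aS]] := set_0Vmem S.
  by apply: trivial => m; have := sCS m; rewrite S0 powerset0.
have [C0|/trivial //] := antichain_dichotomy dC acC.
have cardS : #|S| = #|S :\ a|.+1 by rewrite (cardsD1 a S) aS.
have sDS m : deletion a (C m) \subset powerset (S :\ a).
  apply/subsetP => J; rewrite !inE subsetD1 => /andP[CJ ->]; rewrite andbT.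
  by have := subsetP (sCS m) _ CJ; rewrite inE.
have sLD m := link_sub_deletion a (dC m).
have D0 m : set0 \in deletion a (C m) by rewrite !inE C0.
have boundD := IHs (S :\ a) _ _ sDS (fun m => downset_deletion (dC m))
  (antichain_deletion acC).
have boundL := IHs (S :\ a) _ _ (fun m => subset_trans (sLD m) (sDS m))
  (fun m => downset_link (dC m)) (antichain_link acC).
have ltS : (#|S :\ a| < s)%N by rewrite -ltnS -cardS.
move: (boundD ltS) (boundL ltS) => {}boundD {}boundL.
have x0_le : mean R (fun m => #|deletion a (C m)|) <= (2 ^ #|S :\ a|)%:R.
  rewrite -(mean_const R _ l_ge1) mean_le // => m.
  by rewrite -card_powerset; apply: subset_leq_card; apply: sDS.
have x0_ge : 1 <= mean R (fun m => #|deletion a (C m)|).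
  rewrite -[1]/(1%:R) -(mean_const R _ l_ge1) mean_le // => m.
  by rewrite card_gt0; apply/set0Pn; exists set0.
have le10 : 0 <= mean R (fun m => #|link a (C m)|)
              <= mean R (fun m => #|deletion a (C m)|).
  by rewrite mean_ge0 mean_le // => m; apply: subset_leq_card.
pose U m := shadow_in (S :\ a) (link a (C m)) :|: deletion a (C m).
have leDU : mean R (fun m => #|deletion a (C m)|) <= mean R (fun m => #|U m|).
  by rewrite mean_le // => m; rewrite subset_leq_card ?subsetUr.
(* The empty set is in the deletion but not in the shadow of the link: this
   provides the summand 1. *)
have leLU : 1 + mean R (fun m => #|shadow_in (S :\ a) (link a (C m))|)
              <= mean R (fun m => #|U m|).
  rewrite -[1]/(1%:R) -(mean_const R _ l_ge1) -meanD mean_le // => m.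
  rewrite add1n; apply: proper_card; rewrite properE subsetUl /=.
  apply/subsetPn; exists set0; last exact: set0_notin_shadow.
  by rewrite inE D0 orbT.
have x0_in : 1 <= mean R (fun m => #|deletion a (C m)|) <= (2 ^ #|S :\ a|)%:R.
  by rewrite x0_ge.
move=> k p p01; rewrite (_ : mean R _ = mean R (fun m => #|deletion a (C m)|)
    + mean R (fun m => #|link a (C m)|)); last first.
  rewrite -meanD /mean; congr (_ / _); apply: eq_bigr => m _.
  by rewrite -card_deletion_link.
rewrite cardS => /(expansion_bound_step x0_in le10 boundD boundL leDU leLU p01).
move/le_trans; apply; rewrite -addrA lerD2l -meanD mean_le // => m.
exact: card_shadow_split.
Qed.

Lemma shadow_in_setT (n : nat) (F : {set {set 'I_n}}) :
  shadow_in [set: 'I_n] F = upper_shadow F.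
Proof.
by apply/setP => K; apply/imset2P/imset2P => -[J i FJ]; rewrite ?setTD => iJ ->;
  exists J i; rewrite ?setTD.
Qed.

Theorem proposition25 (R : realFieldType) (n l : nat) (l_ge1 : (1 <= l)%N)
    (C : 'I_l -> {set {set 'I_n}})
    (C_downset : forall m : 'I_l, downset (C m))
    (C_antichain : antichain_condition C)
    (k : nat) (p : R) (p_ge0 : 0 <= p) (p_lt1 : p < 1)
    (avgC : average_card R C =
       \sum_(0 <= i < k) 'C(n, i)%:R + p * 'C(n, k)%:R) :
  average_card R (fun m : 'I_l => upper_shadow (C m)) >=
    \sum_(1 <= i < k.+1) 'C(n, i)%:R + p * 'C(n, k.+1)%:R.
Proof.
have p01 : 0 <= p <= 1 by rewrite p_ge0 ltW.
have sCT m : C m \subset powerset [set: 'I_n].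
  by rewrite powersetT subsetT.
have := @mean_shadow_bound R n l _ C l_ge1 sCT C_downset C_antichain k p p01.
rewrite cardsT card_ord.
rewrite -[mean R _]/(average_card R C) avgC => /(_ (lexx _)).
have -> : mean R (fun m => #|shadow_in [set: 'I_n] (C m)|)
    = average_card R (fun m => upper_shadow (C m)).
  by congr (_ / _); apply: eq_bigr => m _; rewrite shadow_in_setT.
by rewrite /bin_sum big_ltn // bin0 -addrA lerD2l.
Qed.
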